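(* For any natural number $k\ge 1$, the class of $k$-length-segment graphs is a strict subclass of the class of $(k+1)$-length-segment graphs.
   Context: Graphs are finite and simple and classes of graphs are closed under isomorphism. For a nonempty family $\mathcal{F}$ of subsets of $\mathbb{R}^2$, the intersection graph $\mathrm{Int}(\mathcal{F})$ has vertex set $\mathcal{F}$, and two distinct members $A,B\in\mathcal{F}$ are adjacent if and only if $A\cap B\neq\emptyset$. A graph is a $k$-length-segment graph if it is isomorphic to the intersection graph of a family of straight-line segments in the plane having at most $k$ different lengths. *)

(* Defs.v *)
From mathcomp Require Import all_boot all_order all_algebra.
From mathcomp Require Import all_classical all_reals.

Set Implicit Arguments.
Unset Strict Implicit.
Unset Printing Implicit Defensive.

Import Order.TTheory GRing.Theory Num.Theory.

Local Open Scope classical_set_scope.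
Local Open Scope ring_scope.

Record sgraph := SGraph {
  vertex :> finType;
  adj : rel vertex;
  adj_sym : symmetric adj;
  adj_irr : irreflexive adj
}.

Section IntersectionGraphs.
Variable R : realType.

Local Notation plane := 'rV[R]_2.

(* The library's norm on row vectors is the sup norm, hence the explicit
   Euclidean formula. *)
Definition edist (a b : plane) : R :=
  Num.sqrt (\sum_(i < 2) (a 0 i - b 0 i) ^+ 2).

Definition segment (a b : plane) : set plane :=
  [set (1 - t) *: a + t *: b | t in `[0, 1]%classic].

(* Segments are closed and have distinct endpoints. *)
Definition is_segment (S : set plane) : Prop :=
  exists a b, a != b /\ S = segment a b.

(* A segment determines its unordered pair of endpoints, so each segment of F
   contributes exactly one length. *)
Definition lengths (F : set (set plane)) : set R :=
  [set l | exists a b, [/\ a != b, F (segment a b) & l = edist a b]].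

Definition int_adj (A B : set plane) : Prop := A <> B /\ A `&` B !=set0.

Definition isomorphic_to_int (G : sgraph) (F : set (set plane)) : Prop :=
  exists f : G -> set plane,
    set_bij setT F f /\ forall x y : G, adj x y <-> int_adj (f x) (f y).

Definition length_segment_graph (k : nat) (G : sgraph) : Prop :=
  exists F : set (set plane),
    [/\ F !=set0, F `<=` is_segment, (lengths F #<= `I_k)%card
      & isomorphic_to_int G F].

End IntersectionGraphs.

(* Main.v *)
Require Import Defs.
From mathcomp Require Import all_boot all_order all_algebra.
From mathcomp Require Import all_classical all_reals.
From mathcomp Require Import ring lra zify.

(** Inclusion is immediate; the point is a graph that needs k + 1 lengths.

    A segment strictly inside a triangle is shorter than the longest side of
    the triangle, so triangles nested in one another need strictly increasing
    maximal lengths.  The graph below forces nesting by adjacency alone.  It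
    has 2k + 2 triangles T_0, ..., T_(2k+1), each made of three pairwise
    meeting sides, and three paths of spokes: spoke t x meets side t x and the
    spokes t - 1 and t + 1 of the same direction x.  Sides of different
    triangles, spokes of different directions, and a spoke and a side other
    than its own are disjoint.

    Contract T_(t-1) and T_(t+1), with the spokes that lead to them, to points
    p and q.  With the three feet of the spokes on T_t they draw K5 without
    the edge p q.  Modulo two, the number of crossings between independent
    edges of K5 is odd in every drawing; since disjoint segments do not cross,
    T_t separates p from q ([cycle_separates]).  The triangles before T_t and
    the triangles after T_t each form a connected set that avoids T_t, so all
    the former or all the latter lie inside T_t and have smaller maximal
    lengths ([triangle_dichotomy]).  Which of the two occurs depends on t, but
    one kind occurs for at least k + 1 of the 2k + 2 indices, and the maximal
    lengths are distinct on these ([no_few_values]).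

    The bound is attained because the sequence of triangles may be turned
    inside out in the middle: T_0, ..., T_k grow by homotheties of ratio 6 in
    one half-plane, and T_(k+1), ..., T_(2k+1) are their mirror images in the
    other, in decreasing order ([drawing_chain]).  All six segments of a level
    have equal length, so k + 1 lengths suffice.  The graph is defined as the
    intersection graph of this drawing.

    The separation argument uses neither the Jordan curve theorem nor general
    position.  The side of a closed polygon on which a point lies is the
    parity of the edges hit by a horizontal ray, points of equal height being
    ordered by abscissa, and everything rests on an identity for two disjoint
    segments ([hit_duality]). *)

Set Implicit Arguments.
Unset Strict Implicit.
Unset Printing Implicit Defensive.

Import Order.TTheory GRing.Theory Num.Theory.
Local Open Scope classical_set_scope.
Local Open Scope ring_scope.

(** * Segments and the lexicographic order of points *)

Section Planar.
Variable R : realType.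
Local Notation plane := 'rV[R]_2.
Implicit Types (a b c d p q u v w z : plane).

Definition xc z : R := z 0 0.
Definition yc z : R := z 0 1.
Definition pt (x y : R) : plane := \row_j (if j == 0 then x else y).

Lemma xc_pt x y : xc (pt x y) = x. Proof. by rewrite /xc mxE. Qed.
Lemma yc_pt x y : yc (pt x y) = y. Proof. by rewrite /yc mxE. Qed.

Lemma plane_eq u v : xc u = xc v -> yc u = yc v -> u = v.
Proof.
move=> hx hy; apply/rowP => j.
case: j => [[|[|j]] hj] //.
- by rewrite (_ : Ordinal hj = 0) //; apply/val_inj.
- by rewrite (_ : Ordinal hj = 1) //; apply/val_inj.
Qed.

Lemma segmentP a b z : segment a b z <-> exists t : R,
  [/\ 0 <= t, t <= 1, xc z = (1 - t) * xc a + t * xc b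
    & yc z = (1 - t) * yc a + t * yc b].
Proof.
split=> [[t /=]|[t [t0 t1 hx hy]]].
  rewrite in_itv /= => /andP[t0 t1] <-.
  by exists t; split=> //; rewrite /xc /yc !mxE.
exists t; first by rewrite /= in_itv /= t0.
by apply: plane_eq; rewrite /xc /yc !mxE /= ?hx ?hy.
Qed.

Lemma segment_left a b : segment a b a.
Proof. by apply/segmentP; exists 0; split; lra. Qed.
Lemma segment_right a b : segment a b b.
Proof. by apply/segmentP; exists 1; split; lra. Qed.
Lemma segmentC a b : segment a b = segment b a.
Proof.
apply/seteqP; split=> z /segmentP[t [t0 t1 hx hy]]; apply/segmentP;
by exists (1 - t); split; lra.
Qed.

(** Positivity for the functional y + eps * x with eps infinitesimal: points
    are compared by height after an infinitesimal rotation, so that distinct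
    points never have the same height and a ray from p meets no vertex other than p. *)
Definition lexpos (x y : R) := (0 < y) || ((y == 0) && (0 < x)).
Definition below u p := lexpos (xc p - xc u) (yc p - yc u).

(** Twice the signed area: positive when c is on the left of the line from a
    to b. *)
Definition orient a b c : R :=
  (xc b - xc a) * (yc c - yc a) - (yc b - yc a) * (xc c - xc a).

Lemma lexposP x y : reflect (0 < y \/ (y = 0 /\ 0 < x)) (lexpos x y).
Proof.
apply: (iffP orP) => [[->|/andP[/eqP-> ->]]|[->|[-> ->]]];
 by [left|right|rewrite eqxx; right].
Qed.

Lemma eq_lexpos (x y x' y' : R) :
  x = x' -> y = y' -> lexpos x y -> lexpos x' y'.
Proof. by move=> -> ->. Qed.

Lemma lexpos_comb (s t x y x' y' : R) : 0 < s -> 0 < t ->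
  lexpos x y -> lexpos x' y' -> lexpos (s * x + t * x') (s * y + t * y').
Proof.
move=> s0 t0 /lexposP h /lexposP h'; apply/lexposP.
case: h => [h|[-> h]]; case: h' => [h'|[-> h']]; rewrite ?mulr0 ?add0r ?addr0;
 [left|left|left|right; split=> //];
 by rewrite ?addr_gt0 ?mulr_gt0.
Qed.

Lemma lexpos_scale (s x y : R) : lexpos x y -> lexpos (s * x) (s * y) = (0 < s).
Proof.
move=> /lexposP h; apply/lexposP/idP.
  case: h => [h|[-> h]]; rewrite ?mulr0 ?ltxx.
    case=> [|[/eqP]]; first by rewrite pmulr_lgt0.
    by rewrite mulf_eq0 (gt_eqF h) orbF => /eqP ->; rewrite mul0r ltxx.
  by case=> [//|[_]]; rewrite pmulr_lgt0.
by move=> s0; case: h => [h|[-> h]]; [left|right]; rewrite ?mulr0 mulr_gt0.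
Qed.

(** On the half-plane of lexicographically positive vectors the sign of the
    cross product is an order (the order of angles), hence transitive: the
    middle vector times cross x z is a positive combination of x and z. *)
Lemma lexpos_cross (x1 x2 y1 y2 z1 z2 : R) :
  lexpos x1 x2 -> lexpos y1 y2 -> lexpos z1 z2 ->
  0 < x1 * y2 - x2 * y1 -> 0 < y1 * z2 - y2 * z1 -> 0 < x1 * z2 - x2 * z1.
Proof.
move=> hx hy hz hxy hyz.
rewrite -(lexpos_scale _ hy).
have := lexpos_comb hyz hxy hx hz.
by apply: eq_lexpos; ring.
Qed.

Lemma below_trans u v w : below u v -> below v w -> below u w.
Proof.
move=> h1 h2; have := lexpos_comb ltr01 ltr01 h1 h2.
by rewrite /below; apply: eq_lexpos; ring.
Qed.

Lemma below_irr u : below u u = false.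
Proof. by rewrite /below !subrr /lexpos ltxx andbF. Qed.

Lemma belowN u v : u != v -> below v u = ~~ below u v.
Proof.
move=> uv; apply/idP/idP => [h|].
  by apply/negP => h'; move: (below_trans h h'); rewrite below_irr.
rewrite /below => /lexposP h; apply/lexposP.
have [h1|h1|h1] := ltgtP (yc v) (yc u).
- by left; lra.
- by case: h; left; lra.
right; split; first lra.
have [h2|h2|h2] := ltgtP (xc v) (xc u).
- lra.
- by case: h; right; split; lra.
- by case/eqP: uv; apply: plane_eq.
Qed.

Lemma between_on_segment u v p :
  below u p -> below p v -> orient u v p = 0 -> segment u v p.
Proof.
move=> /lexposP h1 /lexposP h2; rewrite /orient => h0; apply/segmentP.
have [yy|yy] := eqVneq (yc v) (yc u).
  have yp : yc p = yc u by case: h1; case: h2; lra.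
  have xu : xc u < xc p by case: h1; lra.
  have xv : xc p < xc v by case: h2; lra.
  exists ((xc p - xc u) / (xc v - xc u)).
  have e : xc v - xc u != 0 by apply/negP => /eqP; lra.
  split.
  - by apply: divr_ge0; lra.
  - by rewrite ler_pdivrMr; lra.
  - by field.
  - by rewrite yp yy; ring.
have yu : yc u <= yc p by case: h1; lra.
have yv : yc p <= yc v by case: h2; lra.
have e : yc v - yc u != 0 by rewrite subr_eq0.
have e0 : 0 < yc v - yc u by rewrite lt_def e; lra.
exists ((yc p - yc u) / (yc v - yc u)); split.
- by apply: divr_ge0; lra.
- by rewrite ler_pdivrMr; lra.
- apply: (mulfI e).
  have -> : (yc v - yc u) * ((1 - (yc p - yc u) / (yc v - yc u)) * xc u + (yc p - yc u) / (yc v - yc u) * xc v) = (yc v - yc p) * xc u + (yc p - yc u) * xc v by field.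
  by lra.
- by field.
Qed.

Lemma crossing_segments_meet u v p q :
  orient u v p * orient u v q < 0 -> orient p q u * orient p q v < 0 ->
  exists z, segment u v z /\ segment p q z.
Proof.
move=> h1 h2.
set s := orient u v p; set t := orient u v q.
set s' := orient p q u; set t' := orient p q v.
have frac (x y : R) : x * y < 0 -> [/\ 0 <= x / (x - y), x / (x - y) <= 1 & x - y != 0].
  move=> xy; have [x0|x0] := ltP 0 x.
    have d : 0 < x - y by nra.
    rewrite ler_pdivrMr // gt_eqF //.
    by split=> //; [apply: divr_ge0; lra|nra].
  have d : 0 < y - x by nra.
  rewrite -[x / _]opprK -mulrN -invrN opprB -mulNr ler_pdivrMr //.
  split; [by apply: divr_ge0; lra|nra|].
  by rewrite lt_eqF //; lra.
have [a0 a1 ne] := frac _ _ h1; have [b0 b1 ne'] := frac _ _ h2.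
rewrite -/s -/t in a0 a1 ne; rewrite -/s' -/t' in b0 b1 ne'.
have E : s' - t' = - (s - t) by rewrite /s /t /s' /t' /orient; ring.
exists (pt ((1 - s / (s - t)) * xc p + s / (s - t) * xc q)
           ((1 - s / (s - t)) * yc p + s / (s - t) * yc q)).
split; apply/segmentP; last first.
  by exists (s / (s - t)); rewrite xc_pt yc_pt.
exists (s' / (s' - t')); rewrite xc_pt yc_pt; split=> //; rewrite E;
 apply: (mulfI ne); rewrite invrN.
- transitivity ((s - t) * xc p + s * (xc q - xc p)); first by field.
  transitivity ((s - t) * xc u - s' * (xc v - xc u)); last by field.
  by rewrite /s /s' /t /orient; ring.
- transitivity ((s - t) * yc p + s * (yc q - yc p)); first by field.
  transitivity ((s - t) * yc u - s' * (yc v - yc u)); last by field.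
  by rewrite /s /s' /t /orient; ring.
Qed.

(** * Crossing parity of two segments *)

Definition disjoint_segments u v p q :=
  forall z, segment u v z -> ~ segment p q z.

Lemma orient_nz u v p : ~ segment u v p -> below u p -> below p v ->
  orient u v p != 0.
Proof. by move=> h h1 h2; apply/negP => /eqP h0; apply/h/between_on_segment. Qed.

(** With levels u < p < v < q, the segments run side by side between the levels
    of p and v.  If p were on the left of u v and v on the left of p q, the
    order of angles of v - u, v - p and q - p would put q on the right of u v
    and u on the right of p q, and the segments would cross; likewise with left
    and right exchanged. *)
Lemma interlaced_sides u v p q : disjoint_segments u v p q ->
  below u p -> below p v -> below v q ->
  (0 < orient u v p) = (orient p q v < 0).
Proof.
move=> dis up pv vq.
have n1 : orient u v p != 0.
  by apply: orient_nz => // h; exact: dis h (segment_left _ _).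
have n2 : orient p q v != 0.
  by apply: orient_nz => // h; exact: dis (segment_right _ _) h.
have pq := below_trans pv vq; have uv := below_trans up pv.
have uq := below_trans up pq.
move: up pv vq pq uv n1 n2; rewrite /below => up pv vq pq uv n1 n2.
have [h1|h1|h1] := ltgtP 0 (orient u v p); last by rewrite -h1 eqxx in n1.
- have [h2|h2|h2] := ltgtP 0 (orient p q v); last by rewrite -h2 eqxx in n2.
    exfalso; rewrite /orient in h1 h2.
    have [] := @crossing_segments_meet u v p q.
    + suff : orient u v q < 0 by rewrite pmulr_rlt0 // /orient.
      rewrite /orient -oppr_gt0.
      have hh := @lexpos_cross _ _ _ _ _ _ vq pv uv.
      have : 0 < (xc q - xc v) * (yc v - yc u) - (yc q - yc v) * (xc v - xc u).
        by apply: hh; lra.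
      by lra.
    + suff : orient p q u < 0 by rewrite mulrC pmulr_rlt0 // /orient.
      have hh := @lexpos_cross _ _ _ _ _ _ pq pv up.
      have : 0 < (xc q - xc p) * (yc p - yc u) - (yc q - yc p) * (xc p - xc u).
        by apply: hh; lra.
      by rewrite /orient; lra.
    + by move=> z [hz hz']; exact: dis hz hz'.
  by [].
- have [h2|h2|h2] := ltgtP 0 (orient p q v) => //.
  exfalso; rewrite /orient in h1 h2.
  have [] := @crossing_segments_meet u v p q.
  + suff : 0 < orient u v q by move=> h; rewrite nmulr_rlt0 // /orient.
    have hh := @lexpos_cross _ _ _ _ _ _ uv pv vq.
    have : 0 < (xc v - xc u) * (yc q - yc v) - (yc v - yc u) * (xc q - xc v).
      by apply: hh; lra.
    by rewrite /orient; lra.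
  + suff : 0 < orient p q u by move=> h; rewrite mulrC nmulr_rlt0 // /orient.
    have hh := @lexpos_cross _ _ _ _ _ _ up pv pq.
    have : 0 < (xc p - xc u) * (yc q - yc p) - (yc p - yc u) * (xc q - xc p).
      by apply: hh; lra.
    by rewrite /orient; lra.
  + by move=> z [hz hz']; exact: dis hz hz'.
Qed.

(** If p and q were on different sides of the line u v, then p q would meet
    this line at a point whose level is between those of u and v. *)
Lemma nested_sides u v p q : disjoint_segments u v p q ->
  below u p -> below p q -> below q v ->
  (0 < orient u v p) = (0 < orient u v q).
Proof.
move=> dis up pq qv.
have pv := below_trans pq qv; have uq := below_trans up pq.
have n1 : orient u v p != 0.
  by apply: orient_nz => // h; exact: dis h (segment_left _ _).
have n2 : orient u v q != 0.
  by apply: orient_nz => // h; exact: dis h (segment_right _ _).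
suff : ~ (orient u v p * orient u v q < 0).
  move=> h; apply/idP/idP => h'; rewrite ltNge; apply/negP => h2; apply: h.
    by rewrite pmulr_rlt0 // lt_neqAle n2.
  by rewrite mulrC pmulr_rlt0 // lt_neqAle n1.
set s := orient u v p; set t := orient u v q => st.
have d : s - t != 0 by apply/negP => /eqP; nra.
set r := s / (s - t).
have [r0 r1] : 0 < r /\ 0 < 1 - r.
  have -> : 1 - r = (- t) / (s - t) by rewrite /r; field.
  rewrite /r; have [s0|s0|s0] := ltgtP 0 s; last by nra.
    by split; apply: divr_gt0; nra.
  by split; rewrite ltr_ndivlMr; nra.
have rd : r * (s - t) = s by rewrite /r; field.
set z := pt ((1 - r) * xc p + r * xc q) ((1 - r) * yc p + r * yc q).
apply: (dis z); last first.
  by apply/segmentP; exists r; rewrite xc_pt yc_pt; split; lra.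
apply: between_on_segment.
- have := lexpos_comb r1 r0 up uq.
  by rewrite /below xc_pt yc_pt; apply: eq_lexpos; ring.
- have := lexpos_comb r1 r0 pv qv.
  by rewrite /below xc_pt yc_pt; apply: eq_lexpos; ring.
- transitivity (s - r * (s - t)); last by rewrite rd subrr.
  by rewrite /s /t /orient xc_pt yc_pt; ring.
Qed.

(** The (infinitesimally rotated) horizontal ray from p to the right crosses
    the segment u v: the level of p separates u from v, and p is on the left
    of the segment oriented upwards. *)
Definition hitR u v p := (below u p (+) below v p) &&
  (0 < if below u p then orient u v p else orient v u p).
Definition hitL u v p := (below u p (+) below v p) &&
  (0 > if below u p then orient u v p else orient v u p).

Lemma orientC u v p : orient v u p = - orient u v p.
Proof. by rewrite /orient; ring. Qed.

Lemma hitRC u v p : hitR u v p = hitR v u p.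
Proof. by rewrite /hitR; case: (below u p); case: (below v p). Qed.
Lemma hitLC u v p : hitL u v p = hitL v u p.
Proof. by rewrite /hitL; case: (below u p); case: (below v p). Qed.

Lemma hitR_hitL u v p : ~ segment u v p ->
  hitR u v p (+) hitL u v p = below u p (+) below v p.
Proof.
move=> out.
have up : u != p by apply: contra_notN out => /eqP <-; apply: segment_left.
have vp : v != p by apply: contra_notN out => /eqP <-; apply: segment_right.
wlog h : u v out up vp / below u p.
  move=> hw; have [h|h] := orP (orbN (below u p)); first by apply: hw.
  have [h'|h'] := orP (orbN (below v p)).
    by rewrite hitRC hitLC [RHS]addbC; apply: hw => //; rewrite segmentC.
  by rewrite /hitR /hitL (negPf h) (negPf h').
rewrite /hitR /hitL h; case: (boolP (below v p)) => //= h'.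
have pv : below p v by rewrite belowN.
by have := orient_nz out h pv; rewrite neq_lt => /orP[] h0; rewrite h0 ltNge ltW.
Qed.

(** Consider the strip on the right of p q between the levels of p and q; hitL
    p q u says that u lies in it.  Since u v does not meet p q, it can enter or
    leave the strip only through the rays from p and from q, so the two rays
    are hit an odd number of times if and only if exactly one of u and v lies
    in the strip. *)
Lemma hit_duality u v p q : disjoint_segments u v p q ->
  hitR u v p (+) hitR u v q = hitL p q u (+) hitL p q v.
Proof.
move=> dis.
have d1 x y : segment u v x -> segment p q y -> x != y.
  by move=> hx hy; apply/eqP => xy; apply: (dis x) => //; rewrite xy.
(* Both sides are symmetric in u and v, and in p and q. *)
wlog uv : u v dis d1 / below u v.
  move=> hw; have [->|ne] := eqVneq u v.
    by rewrite /hitR !addbb.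
  have [h|h] := orP (orbN (below u v)); first by apply: hw.
  rewrite !(hitRC u) [RHS]addbC; apply: hw => //.
  - by rewrite /disjoint_segments segmentC.
  - by rewrite segmentC.
  - by rewrite belowN.
wlog pq : p q dis d1 / below p q.
  move=> hw; have [->|ne] := eqVneq p q.
    by rewrite /hitL !addbb.
  have [h|h] := orP (orbN (below p q)); first by apply: hw.
  rewrite addbC !(hitLC p); apply: hw => //.
  - by move=> z hz; rewrite segmentC; apply: dis.
  - by move=> x y hx; rewrite segmentC; apply: d1.
  - by rewrite belowN.
have [eu ev] := (segment_left u v, segment_right u v).
have [ep eq] := (segment_left p q, segment_right p q).
have dis' : disjoint_segments p q u v by move=> z h h'; apply: (dis z).
have up := d1 _ _ eu ep; have uq := d1 _ _ eu eq.
have vp := d1 _ _ ev ep; have vq := d1 _ _ ev eq.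
have Nup : ~ segment p q u by apply: dis.
have Nvp : ~ segment p q v by apply: dis.
have Npu : ~ segment u v p by apply: dis'.
have Nqu : ~ segment u v q by apply: dis'.
have neg (x : R) : x != 0 -> (x < 0) = ~~ (0 < x) by case: ltgtP.
(* Four relative positions of the levels contribute: p q starts inside u v and
   ends above or inside it, or starts below u and ends above or inside. *)
rewrite /hitR /hitL !(belowN up) !(belowN uq) !(belowN vp) !(belowN vq).
case A: (below u p); case B: (below v p); case C: (below u q); case D: (below v q) => //=;
 try by [move: (below_trans uv B); rewrite A|move: (below_trans uv D); rewrite C
        |move: (below_trans A pq); rewrite C|move: (below_trans B pq); rewrite D].
all: rewrite ?addbF ?addFb.
- apply: interlaced_sides => //; by rewrite belowN ?B ?D.
- rewrite (nested_sides dis A pq) ?addbb //; by rewrite belowN ?D.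
- have pu : below p u by rewrite belowN ?A.
  rewrite !neg ?(nested_sides dis' pu uv D) ?addbb //.
    exact: orient_nz Nvp (below_trans pu uv) D.
  exact: orient_nz Nup pu C.
- have pu : below p u by rewrite belowN ?A.
  have vv : below q v by rewrite belowN ?D.
  rewrite neg ?(interlaced_sides dis' pu C vv) ?neg ?negbK //.
    exact: orient_nz Nqu C vv.
  exact: orient_nz Nup pu C.
Qed.

End Planar.

(** * Chains of segments modulo two *)

Section Chains.
Variable R : realType.
Local Notation plane := 'rV[R]_2.
Implicit Types (a b c d p q u v w z : plane).
Implicit Types (A B : set plane).

Definition chain := seq (plane * plane).
Implicit Types (X Y Z : chain).

(** The boundary of a chain modulo two, given by its pairing with every
    function on the plane; this avoids keeping the edges of a path in order. *)
Definition boundary (phi : plane -> bool) X : bool :=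
  \big[addb/false]_(e <- X) (phi e.1 (+) phi e.2).
Definition hitsR X p : bool := \big[addb/false]_(e <- X) hitR e.1 e.2 p.
Definition hitsL X p : bool := \big[addb/false]_(e <- X) hitL e.1 e.2 p.

Definition carried X A := forall e, e \in X -> segment e.1 e.2 `<=` A.
Definition joins X p q := forall phi, boundary phi X = phi p (+) phi q.

Lemma hitsR_cat X Y p : hitsR (X ++ Y) p = hitsR X p (+) hitsR Y p.
Proof. by rewrite /hitsR big_cat. Qed.
Lemma hitsL_cat X Y p : hitsL (X ++ Y) p = hitsL X p (+) hitsL Y p.
Proof. by rewrite /hitsL big_cat. Qed.

(** Summing [hit_duality] over all pairs of edges. *)
Lemma hits_duality X Y A B : carried X A -> carried Y B -> A `&` B = set0 ->
  boundary (hitsR X) Y = boundary (hitsL Y) X.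
Proof.
move=> XA YB AB0; rewrite /boundary /hitsR /hitsL.
under eq_bigr do rewrite -big_split /=.
under [RHS]eq_bigr do rewrite -big_split /=.
rewrite exchange_big /= big_seq [RHS]big_seq; apply: eq_bigr => e eX.
rewrite big_seq [RHS]big_seq; apply: eq_bigr => e' eY.
apply: hit_duality => z z1 z2.
suff: (A `&` B) z by rewrite AB0.
by split; [exact: XA eX _ z1|exact: YB eY _ z2].
Qed.

Lemma hitsR_hitsL X A p q c : carried X A -> joins X p q -> ~ A c ->
  hitsR X c (+) hitsL X c = below p c (+) below q c.
Proof.
move=> XA jX Ac; rewrite -(jX (fun z => below z c)) /boundary /hitsR /hitsL -big_split /=.
rewrite big_seq [RHS]big_seq; apply: eq_bigr => e eX.
by apply: hitR_hitL => h; exact/Ac/(XA _ eX).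
Qed.

Definition linked A p q := exists X, carried X A /\ joins X p q.

Lemma linked_sym A p q : linked A p q -> linked A q p.
Proof. by move=> [X [h1 h2]]; exists X; split=> // phi; rewrite h2 addbC. Qed.

Lemma linked_trans A q p w : linked A p q -> linked A q w -> linked A p w.
Proof.
move=> [X [X1 X2]] [Y [Y1 Y2]]; exists (X ++ Y); split.
  by move=> e; rewrite mem_cat => /orP[/X1|/Y1].
by move=> phi; rewrite /boundary big_cat /= -/(boundary _ _) X2 -/(boundary _ _) Y2 addbA addbK.
Qed.

Lemma linked_sub A B p q : A `<=` B -> linked A p q -> linked B p q.
Proof.
move=> AB [X [X1 X2]]; exists X; split=> // e /X1 h; exact: subset_trans h AB.
Qed.

Lemma sub_segment a b p q : segment a b p -> segment a b q ->
  segment p q `<=` segment a b.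
Proof.
move=> /segmentP[s [s0 s1 hx hy]] /segmentP[t [t0 t1 kx ky]] z.
move=> /segmentP[r [r0 r1 lx ly]]; apply/segmentP.
exists ((1 - r) * s + r * t); split; [nra|nra| |].
- by rewrite lx hx kx; ring.
- by rewrite ly hy ky; ring.
Qed.

Lemma linked_segment a b p q : segment a b p -> segment a b q ->
  linked (segment a b) p q.
Proof.
move=> hp hq; exists [:: (p, q)]; split.
  by move=> e; rewrite inE => /eqP ->; exact: sub_segment.
by move=> phi; rewrite /boundary big_seq1.
Qed.

(** A closed chain has the same ray parity at all points of a connected set
    that avoids it. *)
Lemma linked_hitsR X A B p q : carried X A -> (forall phi, boundary phi X = false) ->
  A `&` B = set0 -> linked B p q -> hitsR X p = hitsR X q.
Proof.
move=> XA clX AB0 [Y [YB jY]]; have := hits_duality XA YB AB0.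
by rewrite clX jY; case: (hitsR X p); case: (hitsR X q).
Qed.

(** Two routes from p to q, through mx and through my, such that the first
    half of each is disjoint from the second half of the other.  The hits of each
    route at the midpoint of the other one sum up to a contribution of each
    route alone and a comparison of levels. *)
Lemma route_crossings (Px Qx Py Qy : chain) (APx AQx APy AQy : set plane) p q mx my :
  carried Px APx -> carried Qx AQx -> carried Py APy -> carried Qy AQy ->
  joins Px p mx -> joins Qx mx q -> joins Py p my -> joins Qy my q ->
  APx `&` AQy = set0 -> APy `&` AQx = set0 ->
  ~ AQy mx -> ~ AQx my -> mx != my ->
  hitsL (Px ++ Qx) my (+) hitsL (Py ++ Qy) mx =
  (hitsR Qx p (+) hitsL Px q) (+) (hitsR Qy p (+) hitsL Py q) (+)
  ~~ (below q mx (+) below q my).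
Proof.
move=> cPx cQx cPy cQy jPx jQx jPy jQy d1 d2 o1 o2 ne.
have e1 := hits_duality cQy cPx; rewrite setIC d1 jPx jQy in e1.
have e2 := hits_duality cQx cPy; rewrite setIC d2 jPy jQx in e2.
have k1 := hitsR_hitsL cQy jQy o1; have k2 := hitsR_hitsL cQx jQx o2.
have f1 : hitsL Px my = hitsR Qy p (+) hitsR Qy mx (+) hitsL Px q.
  by rewrite e1 // addbK.
have f2 : hitsL Py mx = hitsR Qx p (+) hitsR Qx my (+) hitsL Py q.
  by rewrite e2 // addbK.
have g1 : hitsL Qy mx = hitsR Qy mx (+) (below my mx (+) below q mx).
  by rewrite -k1 addbA addbb.
have g2 : hitsL Qx my = hitsR Qx my (+) (below mx my (+) below q my).
  by rewrite -k2 addbA addbb.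
rewrite !hitsL_cat f1 f2 g1 g2 (belowN ne).
move: (hitsR Qx p) (hitsR Qy p) (hitsR Qx my) (hitsR Qy mx) (hitsL Px q) (hitsL Py q).
move: (below mx my) (below q mx) (below q my).
by do 9!case.
Qed.

(** The parity of K5, with vertices p, q and the three points m x: the triangle
    formed by the S i separates p from q.  By duality along the route through
    m a, the ray parity of S1 differs at p and q by the hits of that route at
    m b and m c, and similarly for S2 and S3.  The six terms are grouped in
    pairs by [route_crossings]; each route contributes twice and so do the
    comparisons with q, which leaves 1 + 1 + 1. *)
Lemma cycle_separates (P Q : option bool -> chain) (AP AQ : option bool -> set plane)
    (m : option bool -> plane) (S1 S2 S3 : chain) (A1 A2 A3 : set plane) p q :
  let a := Some true in let b := None in let c := Some false in
  (forall x, carried (P x) (AP x)) -> (forall x, carried (Q x) (AQ x)) ->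
  (forall x, joins (P x) p (m x)) -> (forall x, joins (Q x) (m x) q) ->
  (forall x, AP x (m x)) -> (forall x, AQ x (m x)) ->
  (forall x y, x != y -> AP x `&` AQ y = set0) ->
  carried S1 A1 -> carried S2 A2 -> carried S3 A3 ->
  joins S1 (m b) (m c) -> joins S2 (m c) (m a) -> joins S3 (m a) (m b) ->
  A1 `&` (AP a `|` AQ a) = set0 -> A2 `&` (AP b `|` AQ b) = set0 ->
  A3 `&` (AP c `|` AQ c) = set0 ->
  hitsR (S1 ++ S2 ++ S3) p (+) hitsR (S1 ++ S2 ++ S3) q = true.
Proof.
move=> a b c cP cQ jP jQ mP mQ dPQ cS1 cS2 cS3 jS1 jS2 jS3 d1 d2 d3.
have off x y : x != y -> ~ AQ y (m x).
  by move=> xy h; have : (AP x `&` AQ y) (m x) by []; rewrite dPQ.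
have ne x y : x != y -> m x != m y.
  by move=> xy; apply/eqP => e; apply: (off _ _ xy); rewrite e.
have two x y (xy : x != y) := route_crossings (cP x) (cQ x) (cP y) (cQ y) (jP x) (jQ x)
  (jP y) (jQ y) (dPQ x y xy) (dPQ y x (contra_neq (@esym _ _ _) xy)) (off _ _ xy)
  (off _ _ (contra_neq (@esym _ _ _) xy)) (ne _ _ xy).
have route x : joins (P x ++ Q x) p q.
  by move=> phi; rewrite /boundary big_cat /= -/(boundary _ _) jP
     -/(boundary _ _) jQ addbA addbK.
have croute x : carried (P x ++ Q x) (AP x `|` AQ x).
  by move=> e; rewrite mem_cat => /orP[/cP|/cQ] h z /h; [left|right].
have e1 := hits_duality cS1 (croute a) d1; rewrite route jS1 in e1.
have e2 := hits_duality cS2 (croute b) d2; rewrite route jS2 in e2.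
have e3 := hits_duality cS3 (croute c) d3; rewrite route jS3 in e3.
transitivity ((hitsR S1 p (+) hitsR S1 q) (+) (hitsR S2 p (+) hitsR S2 q) (+)
              (hitsR S3 p (+) hitsR S3 q)).
  rewrite !hitsR_cat; move: (hitsR S1 p) (hitsR S1 q) (hitsR S2 p) (hitsR S2 q)
    (hitsR S3 p) (hitsR S3 q).
  by do 6!case.
rewrite {}e1 {}e2 {}e3.
transitivity ((hitsL (P a ++ Q a) (m b) (+) hitsL (P b ++ Q b) (m a)) (+)
  (hitsL (P b ++ Q b) (m c) (+) hitsL (P c ++ Q c) (m b)) (+)
  (hitsL (P c ++ Q c) (m a) (+) hitsL (P a ++ Q a) (m c))).
  move: (hitsL _ (m b)) (hitsL _ (m c)) (hitsL _ (m c)) (hitsL _ (m a))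
    (hitsL _ (m a)) (hitsL _ (m b)).
  by do 6!case.
rewrite !two //.
move: (below q (m a)) (below q (m b)) (below q (m c)).
move: (hitsR (Q a) p (+) _) (hitsR (Q b) p (+) _) (hitsR (Q c) p (+) _).
by do 6!case.
Qed.

End Chains.

(** * Points inside a triangle *)

Section Triangles.
Variable R : realType.
Local Notation plane := 'rV[R]_2.
Implicit Types (a b c d g h p q u v w z : plane).
Implicit Types (A B : set plane).

(** For an edge contained in a segment that avoids p, the side on which the
    edge passes p is that of the segment. *)
Lemma hitR_side g h u v p : ~ segment g h p -> below g h ->
  segment g h u -> segment g h v ->
  hitR u v p = (below u p (+) below v p) && (0 < orient g h p).
Proof.
move=> out gh; wlog [hu hv] : u v / below u p /\ ~~ below v p.
  move=> hw su sv; case hu: (below u p); case hv: (below v p).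
  - by rewrite /hitR hu hv.
  - by rewrite (hw u v) ?hu ?hv.
  - by rewrite hitRC (hw v u) ?hu ?hv.
  - by rewrite /hitR hu hv.
move=> su sv; rewrite /hitR hu (negPf hv) /=.
have pv : below p v.
  by rewrite belowN //; apply: contra_notN out => /eqP <-.
have uv := below_trans hu pv.
move: su sv uv; rewrite /below => /segmentP[s [_ _ sx sy]] /segmentP[t [_ _ tx ty]].
have -> : xc v - xc u = (t - s) * (xc h - xc g) by rewrite tx sx; ring.
have -> : yc v - yc u = (t - s) * (yc h - yc g) by rewrite ty sy; ring.
rewrite lexpos_scale // => st.
rewrite -[RHS](pmulr_rgt0 _ st); congr (0 < _).
by rewrite /orient tx sx ty sy; ring.
Qed.

Lemma hitR_collinear g h u v w p : ~ segment g h p ->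
  segment g h u -> segment g h v -> segment g h w ->
  hitR u v p (+) hitR v w p = hitR u w p.
Proof.
move=> out; wlog gh : g h out / below g h.
  move=> hw su sv sw.
  have [e|ne] := eqVneq g h.
    have pt1 z : segment g h z -> z = g.
      rewrite e => /segmentP[t [_ _ hx hy]].
      by apply: plane_eq; rewrite ?hx ?hy; ring.
    by rewrite (pt1 _ su) (pt1 _ sv) (pt1 _ sw) /hitR !addbb.
  have [hh|hh] := orP (orbN (below g h)); first exact: (hw g h).
  by apply: (hw h g); rewrite 1?segmentC // belowN.
move=> su sv sw; rewrite !(hitR_side out gh) //.
by case: (below u p); case: (below v p); case: (below w p); case: (0 < _).
Qed.

Definition strictly_inside u v w p := exists r s t : R,
  [/\ [/\ 0 < r, 0 < s, 0 < t & r + s + t = 1],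
      xc p = r * xc u + s * xc v + t * xc w
    & yc p = r * yc u + s * yc v + t * yc w].

Lemma strictly_inside_rot u v w p :
  strictly_inside u v w p -> strictly_inside v w u p.
Proof.
move=> [r [s [t [[r0 s0 t0 e] hx hy]]]]; exists s, t, r.
by split; [split=> //|rewrite hx|rewrite hy]; lra.
Qed.

Lemma strictly_inside_swap u v w p :
  strictly_inside u v w p -> strictly_inside u w v p.
Proof.
move=> [r [s [t [[r0 s0 t0 e] hx hy]]]]; exists r, t, s.
by split; [split=> //|rewrite hx|rewrite hy]; lra.
Qed.

(** The barycentric coordinates of p are ratios of areas; they are positive because
    p - u, v - p and w - p are lexicographically positive and so are their
    positive combinations. *)
Lemma inside_above_apex u v w p :
  below u p -> below p v -> below p w ->
  0 < orient u v p -> orient u w p < 0 -> strictly_inside u v w p.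
Proof.
move=> up pv pw h1 h2.
set s := - orient u w p; set t := orient u v p.
have s0 : 0 < s by rewrite /s; lra.
have uv := below_trans up pv; have uw := below_trans up pw.
set d := (xc v - xc u) * (yc w - yc u) - (yc v - yc u) * (xc w - xc u).
have d0 : 0 < d.
  rewrite -(lexpos_scale _ up).
  have := lexpos_comb s0 h1 uv uw.
  by apply: eq_lexpos; rewrite /s /t /d /orient; ring.
have r0 : 0 < d - s - t.
  rewrite -(lexpos_scale _ up).
  have := lexpos_comb s0 h1 pv pw.
  by apply: eq_lexpos; rewrite /s /t /d /orient; ring.
have dn : d != 0 by rewrite gt_eqF.
exists ((d - s - t) / d), (s / d), (t / d); split.
- by split; rewrite ?divr_gt0 //; field.
- apply: (mulfI dn); transitivity ((d - s - t) * xc u + s * xc v + t * xc w); last by field.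
  by rewrite /s /t /d /orient; ring.
- apply: (mulfI dn); transitivity ((d - s - t) * yc u + s * yc v + t * yc w); last by field.
  by rewrite /s /t /d /orient; ring.
Qed.

(** The previous case after a half-turn, which preserves [orient]. *)
Lemma inside_below_apex u v w p :
  below p u -> below v p -> below w p ->
  0 < orient u v p -> orient u w p < 0 -> strictly_inside u v w p.
Proof.
have xN z : xc (- z) = - xc z by rewrite /xc mxE.
have yN z : yc (- z) = - yc z by rewrite /yc mxE.
have bN z z' : below (- z) (- z') = below z' z.
  by rewrite /below !xN !yN; congr lexpos; ring.
have oN a b c : orient (- a) (- b) (- c) = orient a b c.
  by rewrite /orient !xN !yN; ring.
rewrite -(bN u) -(bN p v) -(bN p w) -(oN u v) -(oN u w) => h1 h2 h3 h4 h5.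
have [r [s [t [e hx hy]]]] := inside_above_apex h1 h2 h3 h4 h5.
exists r, s, t; split=> //; first by apply: oppr_inj; rewrite -xN hx !xN; ring.
by apply: oppr_inj; rewrite -yN hy !yN; ring.
Qed.

(** The level of p separates u from v and w.  An odd number of hits means that
    p is on different sides of the edges u v and u w. *)
Lemma inside_apex u v w p : ~ segment u v p -> ~ segment u w p ->
  below u p != below v p -> below v p = below w p ->
  hitR u v p (+) hitR u w p -> strictly_inside u v w p.
Proof.
move=> ov ow; wlog h : v w ov ow / 0 < orient u v p.
  move=> hw uv vw hh.
  have [h|h] := ltP 0 (orient u v p); first exact: hw.
  have [h'|h'] := ltP 0 (orient u w p).
    by apply: strictly_inside_swap; apply: hw; rewrite 1?addbC -?vw.
  have nz x : ~ segment u x p -> below u p != below x p -> orient u x p != 0.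
    move=> ox ux.
    have xu : u != p by apply: contra_notN ox => /eqP <-; exact: segment_left.
    have xp : x != p by apply: contra_notN ox => /eqP <-; exact: segment_right.
    case bu: (below u p) ux => ux.
      apply: orient_nz => //; rewrite belowN //; by case: (below x p) ux.
    rewrite -oppr_eq0 -orientC; apply: orient_nz; rewrite 1?segmentC //.
      by case: (below x p) ux.
    by rewrite belowN ?bu.
  have n1 : orient u v p < 0 by rewrite lt_neqAle nz.
  have n2 : orient u w p < 0 by rewrite lt_neqAle nz -?vw.
  move: hh uv; rewrite /hitR -vw !(orientC u).
  case: (below u p); case: (below v p) => //=.
    by rewrite !ltNge !ltW.
  by rewrite !oppr_gt0 n1 n2.
move=> uv vw.
have hu : u != p by apply: contra_notN ov => /eqP <-; exact: segment_left.
have hv : v != p by apply: contra_notN ov => /eqP <-; exact: segment_right.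
have hw : w != p by apply: contra_notN ow => /eqP <-; exact: segment_right.
have [bu|bu] := orP (orbN (below u p)).
  have bv : ~~ below v p by move: uv; rewrite bu; case: (below v p).
  have pv : below p v by rewrite belowN.
  have pw : below p w by rewrite belowN // -vw.
  rewrite /hitR bu -vw (negPf bv) /= h /= -leNgt => h'.
  apply: inside_above_apex => //; rewrite lt_neqAle h' andbT.
  exact: orient_nz.
have bv : below v p by move: uv; rewrite (negPf bu); case: (below v p).
have pu : below p u by rewrite belowN.
have bw : below w p by rewrite -vw.
rewrite /hitR (negPf bu) -vw bv /= !(orientC u) !oppr_gt0 (lt_gtF h) /= => h'.
exact: inside_below_apex.
Qed.

(** An odd number of hits needs two of the vertices on one side of the level of
    p and the third one on the other side; that third vertex is the apex. *)
Lemma odd_hits_inside u v w p :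
  ~ segment u v p -> ~ segment v w p -> ~ segment w u p ->
  hitR u v p (+) hitR v w p (+) hitR w u p -> strictly_inside u v w p.
Proof.
move=> o1 o2 o3.
have [e|e] := boolP (below v p == below w p).
  have [e'|e'] := boolP (below u p == below v p).
    by rewrite /hitR -(eqP e) (eqP e') !addbb.
  have -> : hitR v w p = false by rewrite /hitR (eqP e) addbb.
  rewrite addbF (hitRC w); apply: inside_apex => //; last exact/eqP.
  by rewrite segmentC.
have [e'|e'] := boolP (below w p == below u p).
  have -> : hitR w u p = false by rewrite /hitR (eqP e') addbb.
  rewrite addbF addbC (hitRC u) => hh; do 2!apply: strictly_inside_rot.
  by apply: inside_apex => //; [rewrite segmentC|apply/eqP].
have -> : hitR u v p = false.
  by rewrite /hitR; move: e e'; case: (below u p); case: (below v p); case: (below w p).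
rewrite addFb addbC (hitRC v) => hh; apply: strictly_inside_rot.
apply: inside_apex => //; first by rewrite segmentC.
by move: e e'; case: (below u p); case: (below v p); case: (below w p).
Qed.

Definition dist2 a b : R := (xc a - xc b) ^+ 2 + (yc a - yc b) ^+ 2.

Lemma edistE a b : edist a b = Num.sqrt (dist2 a b).
Proof.
rewrite /edist big_ord_recl big_ord1 /dist2 /xc /yc.
by rewrite (_ : lift ord0 ord0 = 1) //; apply/val_inj.
Qed.

Lemma dist2_ge0 a b : 0 <= dist2 a b.
Proof. by rewrite addr_ge0 ?sqr_ge0. Qed.

Lemma dist2C a b : dist2 a b = dist2 b a.
Proof. by rewrite /dist2; ring. Qed.

Lemma dist2_gt0 a b : a != b -> 0 < dist2 a b.
Proof.
move=> ne; rewrite lt_def dist2_ge0 andbT; apply: contra ne.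
rewrite paddr_eq0 ?sqr_ge0 // !sqrf_eq0 !subr_eq0 => /andP[/eqP h /eqP h'].
by apply/eqP/plane_eq.
Qed.

Lemma edist_segment g h u v : segment g h u -> segment g h v ->
  edist u v <= edist g h.
Proof.
move=> /segmentP[s [s0 s1 sx sy]] /segmentP[t [t0 t1 tx ty]].
rewrite !edistE ler_wsqrtr //.
have -> : dist2 u v = (s - t) ^+ 2 * dist2 g h.
  by rewrite /dist2 sx sy tx ty; ring.
rewrite -[leRHS]mul1r ler_wpM2r ?dist2_ge0 //; nra.
Qed.

(** The formula of Leibniz for a point given by barycentric coordinates. *)
Lemma dist2_comb u v w p z (r s t : R) : r + s + t = 1 ->
  xc p = r * xc u + s * xc v + t * xc w -> yc p = r * yc u + s * yc v + t * yc w ->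
  dist2 p z = r * dist2 u z + s * dist2 v z + t * dist2 w z
    - (r * s * dist2 u v + s * t * dist2 v w + t * r * dist2 w u).
Proof.
move=> e hx hy; have -> : t = 1 - r - s by lra.
have {}e : t = 1 - r - s by lra.
by rewrite /dist2 hx hy e; ring.
Qed.

(** The square of the distance to q is strictly convex, so at p it is smaller
    than its maximum over the vertices, and the distance of q to a vertex is at
    most the length of a side for the same reason. *)
Lemma inside_shorter u v w p q (m : R) : ~ (u = v /\ v = w) ->
  strictly_inside u v w p -> strictly_inside u v w q ->
  edist u v <= m -> edist v w <= m -> edist w u <= m -> edist p q < m.
Proof.
move=> nd [r [s [t [[r0 s0 t0 e] px py]]]] [r' [s' [t' [[r'0 s'0 t'0 e'] qx qy]]]].
move=> h1 h2 h3; have m0 : 0 <= m.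
  by apply: le_trans h1; rewrite edistE sqrtr_ge0.
have mE : m = Num.sqrt (m ^+ 2) by rewrite sqrtr_sqr ger0_norm.
have sq a b : edist a b <= m -> dist2 a b <= m ^+ 2.
  by rewrite edistE {1}mE ler_sqrt // exprn_ge0.
move/sq: h1 => h1; move/sq: h2 => h2; move/sq: h3 => h3.
suff lt2 : dist2 p q < m ^+ 2.
  rewrite edistE mE ltr_sqrt //; apply: le_lt_trans lt2; exact: dist2_ge0.
have nn := dist2_ge0; set M := m ^+ 2 in h1 h2 h3 *.
have M0 : 0 <= M by rewrite exprn_ge0.
have hull z : dist2 z z = 0 by rewrite /dist2 !subrr expr0n addr0.
have [rr ss tt] : [/\ 0 <= r, 0 <= s & 0 <= t] by rewrite !ltW.
have [rr' ss' tt'] : [/\ 0 <= r', 0 <= s' & 0 <= t'] by rewrite !ltW.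
(* The correction term of the formula of Leibniz is positive at p. *)
have pos : 0 < r * s * dist2 u v + s * t * dist2 v w + t * r * dist2 w u.
  have rs := mulr_gt0 r0 s0; have st := mulr_gt0 s0 t0; have tr := mulr_gt0 t0 r0.
  have [uv|uv] := eqVneq u v.
    have /dist2_gt0 vw : v != w by apply/eqP => vw; apply: nd.
    have : 0 < s * t * dist2 v w by rewrite mulr_gt0.
    have : 0 <= r * s * dist2 u v by rewrite !mulr_ge0 ?nn.
    have : 0 <= t * r * dist2 w u by rewrite !mulr_ge0 ?nn.
    lra.
  have : 0 < r * s * dist2 u v by rewrite mulr_gt0 ?dist2_gt0.
  have : 0 <= s * t * dist2 v w by rewrite !mulr_ge0 ?nn.
  have : 0 <= t * r * dist2 w u by rewrite !mulr_ge0 ?nn.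
  lra.
have far z : dist2 u z <= M -> dist2 v z <= M -> dist2 w z <= M -> dist2 z q <= M.
  move=> zu zv zw; rewrite dist2C (dist2_comb _ e' qx qy).
  have A : 0 <= r' * s' * dist2 u v by rewrite !mulr_ge0 ?nn.
  have B : 0 <= s' * t' * dist2 v w by rewrite !mulr_ge0 ?nn.
  have C : 0 <= t' * r' * dist2 w u by rewrite !mulr_ge0 ?nn.
  have D : r' * dist2 u z <= r' * M by rewrite ler_wpM2l.
  have E : s' * dist2 v z <= s' * M by rewrite ler_wpM2l.
  have F : t' * dist2 w z <= t' * M by rewrite ler_wpM2l.
  have -> : M = r' * M + s' * M + t' * M by rewrite -!mulrDl e' mul1r.
  lra.
have D : r * dist2 u q <= r * M.
  by rewrite ler_wpM2l // far ?hull // dist2C.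
have E : s * dist2 v q <= s * M.
  by rewrite ler_wpM2l // far ?hull // dist2C.
have F : t * dist2 w q <= t * M.
  by rewrite ler_wpM2l // far ?hull // dist2C.
rewrite (dist2_comb _ e px py).
have -> : M = r * M + s * M + t * M by rewrite -!mulrDl e mul1r.
lra.
Qed.
End Triangles.

(** * Linked triangles *)

Section TriangleChains.
Variable R : realType.
Local Notation plane := 'rV[R]_2.
Local Notation index := (option bool).
Local Notation ends := (plane * plane)%type.
Implicit Types (p q u v w z : plane).
Implicit Types (A B : set plane) (e f : ends) (x y : index).

Definition seg e : set plane := segment e.1 e.2.
Definition meet e f := seg e `&` seg f !=set0.
Definition apart e f := seg e `&` seg f = set0.

Lemma apartC e f : apart e f -> apart f e.
Proof. by rewrite /apart setIC. Qed.

Lemma apart_notin e f z : apart e f -> seg e z -> ~ seg f z.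
Proof. by move=> ef ez fz; have : (seg e `&` seg f) z by []; rewrite ef. Qed.

(** The three directions, sides and spokes alike, are indexed by option bool:
    Some true and Some false are exchanged by a reflection in the drawing. *)
Record triangle_chain (n : nat) (side spoke : nat -> index -> ends) : Prop := {
  corner : forall t x y, (t < n)%N -> meet (side t x) (side t y);
  foot : forall t x, (t < n)%N -> meet (spoke t x) (side t x);
  joint : forall t x, (t.+1 < n)%N -> meet (spoke t x) (spoke t.+1 x);
  side_side : forall t t' x y, (t < n)%N -> (t' < n)%N -> t != t' ->
    apart (side t x) (side t' y);
  spoke_side : forall t t' x y, (t < n)%N -> (t' < n)%N ->
    (t, x) != (t', y) -> apart (spoke t x) (side t' y);
  spoke_spoke : forall t t' x y, (t < n)%N -> (t' < n)%N -> x != y ->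
    apart (spoke t x) (spoke t' y) }.

Variables (n : nat) (side spoke : nat -> index -> ends).
Hypothesis tc : triangle_chain n side spoke.

Definition triangle t : set plane := \bigcup_x seg (side t x).
(** These sets carry the connections that have to avoid a given triangle. *)
Definition levels (D : pred nat) : set plane :=
  \bigcup_(t in [set t | (t < n)%N && D t]) (triangle t `|` \bigcup_x seg (spoke t x)).
(** The arms from the spoke of direction x at level t to the neighbouring
    triangle t', for varying x, only share that triangle. *)
Definition arm t t' x : set plane :=
  seg (spoke t x) `|` (seg (spoke t' x) `|` triangle t').

Lemma linked_seg A e p q : seg e `<=` A -> seg e p -> seg e q -> linked A p q.
Proof. by move=> eA ep eq; apply: linked_sub eA _; exact: linked_segment. Qed.

Lemma linked_triangle A t p q : (t < n)%N -> triangle t `<=` A ->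
  triangle t p -> triangle t q -> linked A p q.
Proof.
move=> tn tA [x _ xp] [y _ yq]; have [z [zx zy]] := corner tc x y tn.
have sA k : seg (side t k) `<=` A by move=> u ku; apply: tA; exists k.
exact: linked_trans (linked_seg (sA x) xp zx) (linked_seg (sA y) zy yq).
Qed.

Lemma linked_arm t t' x m p : (t < n)%N -> (t' < n)%N ->
  meet (spoke t x) (spoke t' x) -> seg (spoke t x) m -> triangle t' p ->
  linked (arm t t' x) p m.
Proof.
move=> tn t'n [j [jt jt']] tm t'p; have [f [f1 f2]] := foot tc x t'n.
apply: (linked_trans (q := j)); last first.
  by apply: (linked_seg _ jt tm) => z ?; left.
apply: (linked_trans (q := f)); last first.
  by apply: (linked_seg _ f1 jt') => z ?; right; left.
by apply: (linked_triangle t'n _ t'p); [move=> z ?; right; right|exists x].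
Qed.

Lemma linked_levels (D : pred nat) t t' p q : (t <= t' < n)%N ->
  (forall i, (t <= i <= t')%N -> D i) -> triangle t p -> triangle t' q ->
  linked (levels D) p q.
Proof.
elim: t' q => [|t' IH] q /andP[tt' t'n] tD tp t'q.
  move: tt' tD tp; rewrite leqn0 => /eqP -> tD tp.
  apply: (linked_triangle t'n _ tp t'q) => z hz; exists 0%N; last by left.
  by rewrite /= t'n tD.
have sub i z : (t <= i <= t'.+1)%N -> (triangle i z \/ exists x, seg (spoke i x) z) ->
    levels D z.
  move=> ti h; exists i; first by rewrite /= tD // andbT; lia.
  by case: h => [|[x]] h; [left|right; exists x].
move: tt'; rewrite leq_eqVlt => /orP[/eqP e|tt'].
  subst t; apply: (linked_triangle t'n _ tp t'q) => z hz.
  by apply: (sub t'.+1); [lia|left].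
have t'n' : (t' < n)%N by lia.
have [f [f1 f2]] := foot tc None t'n'; have [f' [f1' f2']] := foot tc None t'n.
have [j [j1 j2]] := joint tc None t'n.
have h1 : linked (levels D) p f.
  apply: IH => //; [lia|move=> i hi; apply: tD; lia|by exists None].
apply: linked_trans h1 (linked_trans (linked_seg _ f1 j1) _).
  by move=> z hz; apply: (sub t'); [lia|right; exists None].
apply: linked_trans (linked_seg _ j2 f1') _.
  by move=> z hz; apply: (sub t'.+1); [lia|right; exists None].
apply: (linked_triangle t'n _ _ t'q); last by exists None.
by move=> z hz; apply: (sub t'.+1); [lia|left].
Qed.

Lemma levels_apart (D : pred nat) t : (t < n)%N -> ~~ D t ->
  triangle t `&` levels D = set0.
Proof.
move=> tn tD; apply/seteqP; split=> // z [[x _ zx]] [i /= /andP[iN iD]].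
have ti : t != i by apply: contraNneq tD => ->.
case=> [] [y _ zy]; apply: (apart_notin _ zx zy).
  exact: (side_side tc).
by apply/apartC/(spoke_side tc) => //; rewrite xpair_eqE eq_sym (negPf ti).
Qed.

Definition length_of e : R := edist e.1 e.2.
Definition size_of t : R :=
  Num.max (length_of (side t (Some true)))
    (Num.max (length_of (side t None)) (length_of (side t (Some false)))).

Lemma length_le_size t x : length_of (side t x) <= size_of t.
Proof. by case: x => [[]|]; rewrite /size_of !le_max lexx ?orbT. Qed.

Lemma size_attained t : exists x, size_of t = length_of (side t x).
Proof.
rewrite /size_of /Num.max; case: ifP => _; first case: ifP => _.
- by exists (Some false).
- by exists None.
- by exists (Some true).
Qed.

(** X is a closed chain along T_t that has, off T_t, the ray parity of the
    triangle w u v of the corners, and this parity is odd at p.  A segment at a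
    level of D is linked to p without meeting T_t, so the parity is odd at its
    ends too, and they lie inside the triangle. *)
Lemma shorter_inside t (D : pred nat) u v w X p :
  (t < n)%N -> ~~ D t ->
  seg (side t (Some true)) u -> seg (side t None) u ->
  seg (side t None) v -> seg (side t (Some false)) v ->
  seg (side t (Some false)) w -> seg (side t (Some true)) w ->
  carried X (triangle t) -> (forall phi, boundary phi X = false) ->
  (forall z, ~ triangle t z ->
     hitsR X z = hitR w u z (+) hitR u v z (+) hitR v w z) ->
  hitsR X p ->
  (forall s y, (s < n)%N -> D s -> forall z, seg (side s y) z -> linked (levels D) p z) ->
  forall s, (s < n)%N -> D s -> size_of s < size_of t.
Proof.
move=> tn tD ua ub vb vc wc wa cX dX hX Xp lk s sn sD.
have [y ->] := size_attained s.
have out z : seg (side s y) z -> ~ triangle t z.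
  move=> zs [x _ zx]; apply: (apart_notin _ zx zs); apply: (side_side tc) => //.
  by apply: contraNneq tD => ->.
have hit z : seg (side s y) z -> hitR w u z (+) hitR u v z (+) hitR v w z.
  move=> zs; rewrite -hX; last exact: out.
  by rewrite -(linked_hitsR cX dX (levels_apart tn tD) (lk _ _ sn sD _ zs)).
have ins z : seg (side s y) z -> strictly_inside w u v z.
  move=> zs; apply: odd_hits_inside (hit _ zs) => h; apply: (out z zs).
  - by exists (Some true) => //; exact: (sub_segment wa ua h).
  - by exists None => //; exact: (sub_segment ub vb h).
  - by exists (Some false) => //; exact: (sub_segment vc wc h).
have l := length_le_size t.
apply: (@inside_shorter R w u v).
- move=> [e1 e2]; have := hit _ (segment_left _ _).
  by rewrite e1 e2 /hitR !addbb.
- exact/ins/segment_left.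
- exact/ins/segment_right.
- exact: (le_trans (edist_segment wa ua) (l _)).
- exact: (le_trans (edist_segment ub vb) (l _)).
- exact: (le_trans (edist_segment vc wc) (l _)).
Qed.

(** K5 has the vertices m x (the feet of the three spokes), p in T_(t-1) and
    q in T_(t+1).  At both ends of the chain one alternative is void. *)
Lemma triangle_dichotomy t : (t < n)%N ->
  (forall s, (s < t)%N -> size_of s < size_of t) \/
  (forall s, (t < s < n)%N -> size_of s < size_of t).
Proof.
case: t => [|t] tn; first by left.
have [tn2|] := ltnP t.+2 n; last by right=> s; lia.
have t0n : (t < n)%N by lia.
have [u [ua ub]] := corner tc (Some true) None tn.
have [v [vb vc]] := corner tc None (Some false) tn.
have [w [wc wa]] := corner tc (Some false) (Some true) tn.
have /choice[m mP] : forall x, exists z, (seg (spoke t.+1 x) `&` seg (side t.+1 x)) z.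
  by move=> x; exact: (foot tc x tn).
have ms x : seg (spoke t.+1 x) (m x) by case: (mP x).
have mt x : seg (side t.+1 x) (m x) by case: (mP x).
(* Any points of the two neighbouring triangles would do. *)
set p := (side t None).1; set q := (side t.+2 None).1.
have pt : triangle t p by exists None => //; exact: segment_left.
have qt : triangle t.+2 q by exists None => //; exact: segment_left.
have /choice[P PP] : forall x, exists X, carried X (arm t.+1 t x) /\ joins X p (m x).
  move=> x; apply: linked_arm => //; rewrite /meet setIC; exact: (joint tc x tn).
have /choice[Q QP] : forall x, exists X, carried X (arm t.+1 t.+2 x) /\ joins X (m x) q.
  move=> x; apply: linked_sym; apply: linked_arm => //; exact: (joint tc x tn2).
have arms x y : x != y -> arm t.+1 t x `&` arm t.+1 t.+2 y = set0.
  move=> xy; have yx : y != x by rewrite eq_sym.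
  apply/seteqP; split=> // z.
  have sd i j a b : (i < n)%N -> (j < n)%N -> i != j -> seg (spoke i a) z ->
      seg (side j b) z -> False.
    move=> iN jN ij h h'; apply: (apart_notin _ h h'); apply: (spoke_side tc) => //.
    by rewrite xpair_eqE (negPf ij).
  have ss i j : (i < n)%N -> (j < n)%N -> seg (spoke i x) z ->
      seg (spoke j y) z -> False.
    by move=> iN jN h h'; apply: (apart_notin _ h h'); apply: (spoke_spoke tc).
  case=> [] [h1|[h1|[a _ h1]]] [h2|[h2|[b _ h2]]].
  - by apply: (ss _ _ _ _ h1 h2); lia.
  - by apply: (ss _ _ _ _ h1 h2); lia.
  - by apply: (sd _ _ _ _ _ _ _ h1 h2); lia.
  - by apply: (ss _ _ _ _ h1 h2); lia.
  - by apply: (ss _ _ _ _ h1 h2); lia.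
  - by apply: (sd _ _ _ _ _ _ _ h1 h2); lia.
  - by apply: (sd _ _ _ _ _ _ _ h2 h1); lia.
  - by apply: (sd _ _ _ _ _ _ _ h2 h1); lia.
  - by apply: (apart_notin _ h1 h2); apply: (side_side tc) => //; lia.
have off x y y' : x != y -> x != y' ->
    (seg (side t.+1 y) `|` seg (side t.+1 y')) `&` (arm t.+1 t x `|` arm t.+1 t.+2 x) = set0.
  move=> xy xy'; apply/seteqP; split=> // z [].
  suff h k : x != k -> seg (side t.+1 k) z -> (arm t.+1 t x `|` arm t.+1 t.+2 x) z -> False.
    by case; apply: h.
  move=> xk zk.
  have sp i : (i < n)%N -> ~ seg (spoke i x) z.
    move=> iN h; apply: (apart_notin _ h zk); apply: (spoke_side tc) => //.
    by rewrite xpair_eqE (negPf xk) andbF.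
  have si i a : (i < n)%N -> i != t.+1 -> ~ seg (side i a) z.
    by move=> iN it h; apply: (apart_notin _ h zk); apply: (side_side tc).
  case=> [] [h|[h|[a _ h]]].
  - by apply: (sp _ _ h); lia.
  - by apply: (sp _ _ h); lia.
  - by apply: (si _ _ _ _ h); lia.
  - by apply: (sp _ _ h); lia.
  - by apply: (sp _ _ h); lia.
  - by apply: (si _ _ _ _ h); lia.
(* The edges between the feet run along two sides, through a corner. *)
pose S1 := [:: (m None, v); (v, m (Some false))].
pose S2 := [:: (m (Some false), w); (w, m (Some true))].
pose S3 := [:: (m (Some true), u); (u, m None)].
have cS y y' c : seg (side t.+1 y) c -> seg (side t.+1 y') c ->
    carried [:: (m y, c); (c, m y')] (seg (side t.+1 y) `|` seg (side t.+1 y')).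
  move=> yc y'c e; rewrite !inE => /orP[/eqP ->|/eqP ->] z h.
    by left; exact: (sub_segment (mt y) yc h).
  by right; exact: (sub_segment y'c (mt y') h).
have jS y y' c : joins [:: (m y, c); (c, m y')] (m y) (m y').
  by move=> phi; rewrite /boundary big_cons big_seq1 /= addbA addbK.
have sep := cycle_separates (fun x => (PP x).1) (fun x => (QP x).1)
  (fun x => (PP x).2) (fun x => (QP x).2) (fun x => or_introl (ms x))
  (fun x => or_introl (ms x)) arms (cS None (Some false) v vb vc)
  (cS (Some false) (Some true) w wc wa) (cS (Some true) None u ua ub)
  (jS _ _ _) (jS _ _ _) (jS _ _ _) (off (Some true) None (Some false) isT isT)
  (off None (Some false) (Some true) isT isT)
  (off (Some false) (Some true) None isT isT).
set X := S1 ++ S2 ++ S3 in sep.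
have cX : carried X (triangle t.+1).
  have tri y : seg (side t.+1 y) `<=` triangle t.+1 by move=> z h; exists y.
  have sub y y' : seg (side t.+1 y) `|` seg (side t.+1 y') `<=` triangle t.+1.
    by move=> z [] /tri.
  move=> e; rewrite !mem_cat => /or3P[] h.
  - exact: (subset_trans (cS _ _ _ vb vc _ h) (sub _ _)).
  - exact: (subset_trans (cS _ _ _ wc wa _ h) (sub _ _)).
  - exact: (subset_trans (cS _ _ _ ua ub _ h) (sub _ _)).
have dX phi : boundary phi X = false.
  rewrite /X /boundary !big_cat /= -!/(boundary _ _) !jS.
  by case: (phi _); case: (phi _); case: (phi _).
(* Inserting a foot between two corners of a side does not change the parity. *)
have hX z : ~ triangle t.+1 z ->
    hitsR X z = hitR w u z (+) hitR u v z (+) hitR v w z.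
  move=> out; have o x : ~ seg (side t.+1 x) z by move=> h; apply: out; exists x.
  rewrite -(hitR_collinear (o _) wa (mt (Some true)) ua).
  rewrite -(hitR_collinear (o _) ub (mt None) vb).
  rewrite -(hitR_collinear (o _) vc (mt (Some false)) wc).
  rewrite /X /hitsR !big_cons big_nil /=.
  move: (hitR _ _ z) (hitR _ _ z) (hitR _ _ z) (hitR _ _ z) (hitR _ _ z) (hitR _ _ z).
  by do 6!case.
have [Xp|Xp] := boolP (hitsR X p); [left=> s st|right=> s st].
  apply: (shorter_inside (D := fun i => (i < t.+1)%N) tn _ ua ub vb vc wc wa cX dX hX Xp) => //.
  - by rewrite ltnn.
  - move=> i y iN it z zi; apply: linked_sym.
    apply: (@linked_levels _ i t) pt; [lia|move=> k hk; lia|by exists y].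
  - lia.
move: sep; rewrite (negPf Xp) /= => Xq.
apply: (shorter_inside (D := fun i => (t.+1 < i)%N) tn _ ua ub vb vc wc wa cX dX hX Xq) => //.
- by rewrite ltnn.
- move=> i y iN it z zi.
  apply: (@linked_levels _ t.+2 i) qt _; [lia|move=> k hk; lia|by exists y].
- lia.
- lia.
Qed.

End TriangleChains.

(** M is injective on the indices satisfying the first alternative, where it
    increases, and on the others, where it decreases; one of these two sets has
    more than k elements. *)
Lemma no_few_values (R : realType) (k : nat) (M : nat -> R) (L : set R) :
  (forall t, (t < k.*2.+2)%N -> L (M t)) ->
  (forall t, (t < k.*2.+2)%N ->
     (forall s, (s < t)%N -> M s < M t) \/
     (forall s, (t < s < k.*2.+2)%N -> M s < M t)) ->
  (L #<= `I_k)%card -> False.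
Proof.
move=> ML dich Lk; set n := k.*2.+2.
pose up := [pred t : 'I_n | `[< forall s, (s < t)%N -> M s < M t >] ].
have few (P : pred 'I_n) : {in P &, injective (fun t : 'I_n => M t)} -> (#|P| <= k)%N.
  move=> inj; rewrite -card_le_II; apply: card_le_trans Lk.
  (* An enumeration of P by an initial segment of nat, to compare with k. *)
  pose f i := M (nth ord0 (enum P) i).
  have finj : {in `I_#|P| &, injective f}.
    move=> i j; rewrite !inE /= => iP jP e; apply/eqP.
    rewrite -(nth_uniq ord0 _ _ (enum_uniq P)) -?cardE //; apply/eqP/inj => //.
    - by rewrite -mem_enum mem_nth // -cardE.
    - by rewrite -mem_enum mem_nth // -cardE.
  have /card_eqPle[_ h] := inj_card_eq finj; apply: card_le_trans h _.
  by apply: subset_card_le => _ [i _ <-]; apply: ML.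
have inj1 : {in up &, injective (fun t : 'I_n => M t)}.
  have upP t : t \in up -> forall s, (s < t)%N -> M s < M t by rewrite inE.
  move=> s t /upP us /upP ut e; apply/val_inj => /=.
  by case: (ltngtP s t) => // [/ut|/us]; rewrite e ltxx.
have inj2 : {in predC up &, injective (fun t : 'I_n => M t)}.
  have down t : t \in predC up -> forall s, (t < s < n)%N -> M s < M t.
    case: (dich t (ltn_ord t)) => // h.
    by rewrite inE => /negP nup; case: nup; apply/asboolP.
  move=> s t /down ds /down dt e; apply/val_inj => /=.
  case: (ltngtP s t) => // h.
    by have := ds t; rewrite h ltn_ord e ltxx => /(_ isT).
  by have := dt s; rewrite h ltn_ord e ltxx => /(_ isT).
have := leq_add (few _ inj1) (few _ inj2); rewrite cardC card_ord /n; lia.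
Qed.

(** * A drawing with few lengths *)

Section Drawing.
Variables (R : realType).
Local Notation plane := 'rV[R]_2.
Local Notation index := (option bool).
Implicit Types (sg s S X Y : R) (x y : index) (w : bool) (z : plane).

(** The frame of a level: a homothety of ratio s, a translation that puts the
    vertical axis of symmetry of the whole drawing at the origin, and a
    reflection in this axis when sg is -1. *)
Definition place sg s S X Y : plane := pt (sg * (s * X + 624 * S)) (s * Y).

(** All segments have length 650, by the triples (3, 4, 5) and (5, 12, 13).
    The spokes lie on the lines through the origin, and the outer end of a
    spoke is 6 times its inner end.  The spokes Some true and Some false end at
    abscissa -624, which gives the position of the axis in [place]. *)
Definition inner_end w x : R * R :=
  match w, x with
  | false, Some b => (140, 0)
  | false, None => (-440, -325)
  | true, Some b => (-104, if b then 78 else -78)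
  | true, None => (-130, 0)
  end.

Definition outer_end w x : R * R :=
  match w, x with
  | false, Some b => (-460, if b then 250 else -250)
  | false, None => (-440, 325)
  | true, Some b => (-624, if b then 468 else -468)
  | true, None => (-780, 0)
  end.

Definition part_ends sg s S w x : plane * plane :=
  (place sg s S (inner_end w x).1 (inner_end w x).2,
   place sg s S (outer_end w x).1 (outer_end w x).2).

(** The segments in the coordinates of their frame.  Being linear in X, Y and
    s, these conditions reduce all incidences to linear arithmetic. *)
Definition part_locus s w x X Y : Prop :=
  match w, x with
  | false, None => [/\ X = -440 * s, -325 * s <= Y & Y <= 325 * s]
  | false, Some true => [/\ 5 * X + 12 * Y = 700 * s, 0 <= Y & Y <= 250 * s]
  | false, Some false => [/\ 5 * X - 12 * Y = 700 * s, Y <= 0 & -250 * s <= Y]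
  | true, None => [/\ Y = 0, -780 * s <= X & X <= -130 * s]
  | true, Some true => [/\ 3 * X + 4 * Y = 0, 78 * s <= Y & Y <= 468 * s]
  | true, Some false => [/\ 3 * X - 4 * Y = 0, -468 * s <= Y & Y <= -78 * s]
  end.

Lemma part_locusP sg s S w x z : sg ^+ 2 = 1 -> 0 < s ->
  seg (part_ends sg s S w x) z <->
  part_locus s w x (sg * xc z - 624 * S) (yc z).
Proof.
move=> sg1 s0; have sn : s != 0 by rewrite gt_eqF.
have sgz X : xc z = sg * X <-> sg * xc z = X.
  split=> [->|<-]; first by rewrite mulrA -expr2 sg1 mul1r.
  by rewrite mulrA -expr2 sg1 mul1r.
set X := sg * xc z - 624 * S; set Y := yc z.
have main a b c d : seg (place sg s S a b, place sg s S c d) z <->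
    exists t : R, [/\ 0 <= t, t <= 1, X = s * ((1 - t) * a + t * c)
      & Y = s * ((1 - t) * b + t * d)].
  rewrite /seg /= segmentP /place; split=> [] [t [t0 t1 hx hy]]; exists t; split=> //.
  - move: hx; rewrite !xc_pt => hx; rewrite /X hx.
    transitivity (sg ^+ 2 * ((1 - t) * (s * a + 624 * S) + t * (s * c + 624 * S)) - 624 * S); first by ring.
    by rewrite sg1; ring.
  - by rewrite /Y hy !yc_pt; ring.
  - rewrite !xc_pt; transitivity (sg * (X + 624 * S)); last by rewrite hx; ring.
    by apply/sgz; rewrite /X; ring.
  - by rewrite !yc_pt -/Y hy; ring.
have frac (a b : R) : 0 <= a -> a <= b * s -> 0 < b -> 0 <= a / (b * s) /\ a / (b * s) <= 1.
  move=> a0 ab b0; have bs : 0 < b * s by rewrite mulr_gt0.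
  by split; [exact: divr_ge0 a0 (ltW bs)|rewrite ler_pdivrMr // mul1r].
case: w x => [] [[]|]; rewrite /part_ends /part_locus main /=; split.
- by move=> [t [t0 t1 -> ->]]; split; nra.
- move=> [h1 h2 h3]; exists ((Y - 78 * s) / (390 * s)).
  have [|||A B] := frac (Y - 78 * s) 390; [lra..|]; split=> //; last by field.
  have -> : X = - (4 / 3) * Y by lra.
  by field.
- by move=> [t [t0 t1 -> ->]]; split; nra.
- move=> [h1 h2 h3]; exists ((- Y - 78 * s) / (390 * s)).
  have [|||A B] := frac (- Y - 78 * s) 390; [lra..|]; split=> //; last by field.
  have -> : X = (4 / 3) * Y by lra.
  by field.
- by move=> [t [t0 t1 -> ->]]; split; nra.
- move=> [h1 h2 h3]; exists ((- X - 130 * s) / (650 * s)).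
  have [|||A B] := frac (- X - 130 * s) 650; [lra..|]; split=> //; first by field.
  by rewrite h1; ring.
- by move=> [t [t0 t1 -> ->]]; split; nra.
- move=> [h1 h2 h3]; exists (Y / (250 * s)).
  have [|||A B] := frac Y 250; [lra..|]; split=> //; last by field.
  have -> : X = 140 * s - (12 / 5) * Y by lra.
  by field.
- by move=> [t [t0 t1 -> ->]]; split; nra.
- move=> [h1 h2 h3]; exists (- Y / (250 * s)).
  have [|||A B] := frac (- Y) 250; [lra..|]; split=> //; last by field.
  have -> : X = 140 * s + (12 / 5) * Y by lra.
  by field.
- by move=> [t [t0 t1 -> ->]]; split; nra.
- move=> [h1 h2 h3]; exists ((Y + 325 * s) / (650 * s)).
  have [|||A B] := frac (Y + 325 * s) 650; [lra..|]; split=> //; last by field.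
  by rewrite h1; ring.
Qed.

Lemma part_length sg s S w x : sg ^+ 2 = 1 -> 0 < s ->
  length_of (part_ends sg s S w x) = 650 * s.
Proof.
move=> sg1 s0; rewrite /length_of edistE.
have -> : 650 * s = Num.sqrt ((650 * s) ^+ 2) by rewrite sqrtr_sqr ger0_norm //; lra.
congr Num.sqrt; rewrite /dist2; case: w x => [] [[]|];
rewrite /part_ends /= /place !xc_pt !yc_pt -!mulrBr !exprMn sg1; ring.
Qed.

Lemma locus_same s w w' x x' X Y : 0 < s -> x != x' -> w || w' ->
  part_locus s w x X Y -> part_locus s w' x' X Y -> False.
Proof.
move=> s0; case: w w' x x' => [] [] [[]|] [[]|] //= _ _ [h1 h2 h3] [k1 k2 k3]; lra.
Qed.

(** The inner level, of scale s, lies inside the triangle of the outer one, of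
    scale s', and the outer spokes start beyond the inner sides. *)
Lemma locus_far s s' w w' x x' X Y : 0 < s -> 6 * s <= s' ->
  ~~ [&& w, w' & x == x'] ->
  part_locus s w x X Y -> part_locus s' w' x' X Y -> False.
Proof.
move=> s0 ss; case: w w' x x' => [] [] [[]|] [[]|] //= _ [h1 h2 h3] [k1 k2 k3]; lra.
Qed.

Lemma locus_reach s w x X Y : 0 < s -> part_locus s w x X Y ->
  (if w then -780 else -460) * s <= X.
Proof. by move=> s0; case: w x => [] [[]|] /= [h1 h2 h3]; lra. Qed.

(** Segments on both sides of the axis: x and - x - 1248 S are abscissas of one
    point in the two frames.  Only the outermost spoke None reaches beyond the
    axis, and by less than the distance from the axis to a mirrored side. *)
Lemma locus_mirror s s' S w w' x x' X Y :
  0 < s -> 0 < s' -> s <= S -> s' <= S -> ~~ [&& w, w' & x == x'] ->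
  part_locus s w x X Y -> part_locus s' w' x' (- X - 1248 * S) Y -> False.
Proof.
move=> s0 s0' sS sS' ww h h'.
have := locus_reach s0 h; have := locus_reach s0' h'.
case: w w' ww h h' => [] [] /= ww h h' r r'; try lra.
by move: x x' ww h h' {r r'} => [[]|] [[]|] //= _ [h1 h2 h3] [k1 k2 k3]; lra.
Qed.

Lemma inner_locus s w x : 0 < s ->
  part_locus s w x (s * (inner_end w x).1) (s * (inner_end w x).2).
Proof. by move=> s0; case: w x => [] [[]|] /=; split; lra. Qed.

Lemma outer_locus s w x : 0 < s ->
  part_locus s w x (s * (outer_end w x).1) (s * (outer_end w x).2).
Proof. by move=> s0; case: w x => [] [[]|] /=; split; lra. Qed.

Lemma outer_other_side s x x' : 0 < s -> x != x' ->
  ~ part_locus s false x' (s * (outer_end false x).1) (s * (outer_end false x).2).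
Proof. by move=> s0; case: x x' => [[]|] [[]|] //= _ [h1 h2 h3]; lra. Qed.

Lemma inner_spoke_side s x x' : 0 < s ->
  ~ part_locus s false x' (s * (inner_end true x).1) (s * (inner_end true x).2).
Proof. by move=> s0; case: x x' => [[]|] [[]|] /= [h1 h2 h3]; lra. Qed.

Lemma inner_far s s' x : 0 < s -> 6 * s <= s' ->
  ~ part_locus s' true x (s * (inner_end true x).1) (s * (inner_end true x).2).
Proof. by move=> s0 ss; case: x => [[]|] /= [? ? ?]; lra. Qed.

Lemma inner_mirror s s' S x : 0 < s -> 0 < s' -> s <= S -> s' <= S ->
  ~ part_locus s' true x (- (s * (inner_end true x).1) - 1248 * S)
      (s * (inner_end true x).2).
Proof. by move=> s0 s0' sS sS'; case: x => [[]|] /= [? ? ?]; lra. Qed.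

Lemma locus_corner s x y : 0 < s ->
  exists X Y, part_locus s false x X Y /\ part_locus s false y X Y.
Proof.
move=> s0; case: x y => [[]|] [[]|].
- by exists (140 * s), 0; split; split; lra.
- by exists (140 * s), 0; split; split; lra.
- by exists (- 440 * s), (725 / 3 * s); split; split; lra.
- by exists (140 * s), 0; split; split; lra.
- by exists (140 * s), 0; split; split; lra.
- by exists (- 440 * s), (- (725 / 3) * s); split; split; lra.
- by exists (- 440 * s), (725 / 3 * s); split; split; lra.
- by exists (- 440 * s), (- (725 / 3) * s); split; split; lra.
- by exists (- 440 * s), 0; split; split; lra.
Qed.

Lemma locus_foot s x : 0 < s ->
  exists X Y, part_locus s true x X Y /\ part_locus s false x X Y.
Proof.
move=> s0; case: x => [[]|].
- by exists (- 175 * s), (525 / 4 * s); split; split; lra.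
- by exists (- 175 * s), (- (525 / 4) * s); split; split; lra.
- by exists (- 440 * s), 0; split; split; lra.
Qed.

Lemma locus_joint s x : 0 < s ->
  exists X Y, part_locus s true x X Y /\ part_locus (6 * s) true x X Y.
Proof.
move=> s0; exists (s * (outer_end true x).1), (s * (outer_end true x).2).
by split; [exact: outer_locus|case: x => [[]|] /=; split; lra].
Qed.

Lemma locus_axis s x : 0 < s ->
  exists X Y, part_locus s true x X Y /\ part_locus s true x (- X - 1248 * s) Y.
Proof.
move=> s0; case: x => [[]|].
- by exists (- 624 * s), (468 * s); split; split; lra.
- by exists (- 624 * s), (- 468 * s); split; split; lra.
- by exists (- 624 * s), 0; split; split; lra.
Qed.

Variable k : nat.

(** The levels are 0, ..., k, k, ..., 0. *)
Definition scale t : R := 6 ^+ minn t (k.*2.+1 - t).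
Definition mirror_sign t : R := if (t <= k)%N then 1 else -1.
Definition part t w x : plane * plane := part_ends (mirror_sign t) (scale t) (6 ^+ k) w x.

Lemma sign_sqr t : mirror_sign t ^+ 2 = 1.
Proof. by rewrite /mirror_sign; case: ifP => _; rewrite ?sqrrN expr1n. Qed.

Lemma scale_gt0 t : 0 < scale t.
Proof. by rewrite exprn_gt0. Qed.

Lemma scale_le t : (t < k.*2.+2)%N -> scale t <= 6 ^+ k.
Proof. by move=> tn; rewrite ler_weXn2l ?ler1n //; lia. Qed.

Lemma sign_scale t t' : (t < k.*2.+2)%N -> (t' < k.*2.+2)%N -> t != t' ->
  (mirror_sign t = mirror_sign t' /\ (6 * scale t <= scale t' \/ 6 * scale t' <= scale t)) \/
  mirror_sign t' = - mirror_sign t.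
Proof.
move=> tn t'n tt.
have mono i j : (i < j)%N -> 6 * 6 ^+ i <= 6 ^+ j :> R.
  by move=> ij; rewrite -exprS ler_weXn2l ?ler1n.
rewrite /mirror_sign /scale; case: (leqP t k) => h; case: (leqP t' k) => h'.
- by left; split=> //; case: (ltngtP t t') => e; [left|right|]; try apply: mono; lia.
- by right.
- by right; rewrite opprK.
- by left; split=> //; case: (ltngtP t t') => e; [right|left|]; try apply: mono; lia.
Qed.

(** The abscissa of a point, measured from the centre of the homothety of
    level t. *)
Definition frame t z : R := mirror_sign t * xc z - 624 * 6 ^+ k.

Lemma partP t w x z : seg (part t w x) z <-> part_locus (scale t) w x (frame t z) (yc z).
Proof. exact: part_locusP (sign_sqr t) (scale_gt0 t). Qed.

Lemma frame_surj t X Y : exists z, frame t z = X /\ yc z = Y.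
Proof.
exists (pt (mirror_sign t * (X + 624 * 6 ^+ k)) Y); rewrite /frame xc_pt yc_pt mulrA -expr2.
by rewrite sign_sqr; split=> //; ring.
Qed.

Lemma frame_same t t' z : mirror_sign t = mirror_sign t' -> frame t z = frame t' z.
Proof. by rewrite /frame => ->. Qed.

Lemma frame_mirror t t' z : mirror_sign t' = - mirror_sign t -> frame t' z = - frame t z - 1248 * 6 ^+ k.
Proof. by rewrite /frame => ->; ring. Qed.

Lemma part_apart t t' w w' x x' : (t < k.*2.+2)%N -> (t' < k.*2.+2)%N ->
  t != t' -> ~~ [&& w, w' & x == x'] -> apart (part t w x) (part t' w' x').
Proof.
move=> tn t'n tt ww; apply/seteqP; split=> // z [/partP h /partP h'].
have ww' : ~~ [&& w', w & x' == x].
  by move: ww; rewrite [x' == x]eq_sym; case: w {h}; case: w' {h'}.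
case: (sign_scale tn t'n tt) => [[e [ss|ss]]|e].
- by rewrite -(frame_same z e) in h'; exact: (locus_far (scale_gt0 t) ss ww h h').
- by rewrite -(frame_same z e) in h'; exact: (locus_far (scale_gt0 t') ss ww' h' h).
- rewrite (frame_mirror z e) in h'.
  exact: (locus_mirror (scale_gt0 t) (scale_gt0 t') (scale_le tn) (scale_le t'n) ww h h').
Qed.

Lemma part_apart_level t w w' x x' : x != x' -> w || w' ->
  apart (part t w x) (part t w' x').
Proof.
move=> xx ww; apply/seteqP; split=> // z [/partP h /partP h'].
exact: (locus_same (scale_gt0 t) xx ww h h').
Qed.

Lemma part_meet t w w' x x' :
  (exists X Y, part_locus (scale t) w x X Y /\ part_locus (scale t) w' x' X Y) ->
  meet (part t w x) (part t w' x').
Proof.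
move=> [X [Y [h h']]]; have [z [zx zy]] := frame_surj t X Y.
by exists z; split; apply/partP; rewrite zx zy.
Qed.

Lemma drawing_chain :
  triangle_chain k.*2.+2 (fun t => part t false) (fun t => part t true).
Proof.
split=> /=.
- by move=> t x y _; apply: part_meet; exact: locus_corner (scale_gt0 t).
- by move=> t x _; apply: part_meet; exact: locus_foot (scale_gt0 t).
- move=> t x tn.
  have [tk|tk] := ltnP t k.
    have ss : scale t.+1 = 6 * scale t.
      by rewrite /scale -exprS; congr (_ ^+ _); lia.
    have bb : mirror_sign t = mirror_sign t.+1 by rewrite /mirror_sign ltnW // tk.
    have [X [Y [h h']]] := locus_joint x (scale_gt0 t).
    have [z [zx zy]] := frame_surj t X Y.
    by exists z; split; apply/partP; rewrite -?(frame_same z bb) zx zy ?ss.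
  move: tk; rewrite leq_eqVlt => /orP[/eqP tk|tk].
    have s1 : scale t = 6 ^+ k by rewrite /scale; congr (_ ^+ _); lia.
    have s2 : scale t.+1 = 6 ^+ k by rewrite /scale; congr (_ ^+ _); lia.
    have bb : mirror_sign t.+1 = - mirror_sign t by rewrite /mirror_sign -tk leqnn ltnn.
    have [X [Y [h h']]] := locus_axis x (scale_gt0 t).
    have [z [zx zy]] := frame_surj t X Y.
    exists z; split; apply/partP; first by rewrite zx zy.
    by rewrite (frame_mirror z bb) zx zy s2 -s1.
  have ss : scale t = 6 * scale t.+1.
    by rewrite /scale -exprS; congr (_ ^+ _); lia.
  have bb : mirror_sign t = mirror_sign t.+1.
    by rewrite /mirror_sign [(t <= k)%N]leqNgt tk ltnNge (ltnW tk).
  have [X [Y [h h']]] := locus_joint x (scale_gt0 t.+1).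
  have [z [zx zy]] := frame_surj t X Y.
  by exists z; split; apply/partP; rewrite -?(frame_same z bb) zx zy ?ss.
- by move=> t t' x y tn t'n tt; apply: part_apart.
- move=> t t' x y tn t'n; have [<-|tt] := eqVneq t t'; last first.
    by move=> _; apply: part_apart; rewrite ?andbF.
  by rewrite xpair_eqE eqxx /= => xy; apply: part_apart_level.
- move=> t t' x y tn t'n xy; have [<-|tt] := eqVneq t t'.
    exact: part_apart_level.
  by apply: part_apart; rewrite //= (negPf xy).
Qed.

Lemma inner_in_part t w x z : frame t z = scale t * (inner_end w x).1 ->
  yc z = scale t * (inner_end w x).2 -> seg (part t w x) z.
Proof. by move=> zx zy; apply/partP; rewrite zx zy; exact/inner_locus/scale_gt0. Qed.

Lemma outer_in_part t w x z : frame t z = scale t * (outer_end w x).1 ->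
  yc z = scale t * (outer_end w x).2 -> seg (part t w x) z.
Proof. by move=> zx zy; apply/partP; rewrite zx zy; exact/outer_locus/scale_gt0. Qed.

Lemma part_inj t t' w w' x x' : (t < k.*2.+2)%N -> (t' < k.*2.+2)%N ->
  seg (part t w x) = seg (part t' w' x') -> (t, (w, x)) = (t', (w', x')).
Proof.
move=> tn t'n e.
have ap : ~ apart (part t w x) (part t' w' x').
  move=> /apart_notin h; apply: (h (part t w x).1); first exact: segment_left.
  by rewrite -e; exact: segment_left.
have inn v y : exists z, frame v z = scale v * (inner_end true y).1 /\
    yc z = scale v * (inner_end true y).2 by exact: frame_surj.
have [tt|tt] := eqVneq t t'.
  subst t'; case: w w' e ap => [] [] e ap.
  - by have [->//|xx] := eqVneq x x'; case: ap; exact: part_apart_level.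
  - have [z [zx zy]] := inn t x; have := inner_in_part zx zy.
    by rewrite e => /partP; rewrite zx zy => /(inner_spoke_side (scale_gt0 t)).
  - have [z [zx zy]] := inn t x'; have := inner_in_part zx zy.
    by rewrite -e => /partP; rewrite zx zy => /(inner_spoke_side (scale_gt0 t)).
  - have [->//|xx] := eqVneq x x'.
    have [z [zx zy]] := frame_surj t (scale t * (outer_end false x).1)
      (scale t * (outer_end false x).2).
    have := outer_in_part zx zy; rewrite e => /partP.
    by rewrite zx zy => /(outer_other_side (scale_gt0 t) xx).
exfalso; have [/and3P[hw hw' /eqP hx]|ww] := boolP [&& w, w' & x == x']; last first.
  by apply: ap; exact: part_apart.
move: e ap; rewrite {}hw {}hw' -{}hx => e _.
case: (sign_scale tn t'n tt) => [[bb [ss|ss]]|bb].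
(* For spokes of the same direction, the inner end of one is not on the other. *)
- have [z [zx zy]] := inn t x; have := inner_in_part zx zy.
  rewrite e => /partP; rewrite -(frame_same z bb) zx zy.
  exact: inner_far (scale_gt0 t) ss.
- have [z [zx zy]] := inn t' x; have := inner_in_part zx zy.
  rewrite -e => /partP; rewrite (frame_same z bb) zx zy.
  exact: inner_far (scale_gt0 t') ss.
- have [z [zx zy]] := inn t x; have := inner_in_part zx zy.
  rewrite e => /partP; rewrite (frame_mirror z bb) zx zy.
  exact: (inner_mirror (scale_gt0 t) (scale_gt0 t') (scale_le tn) (scale_le t'n)).
Qed.

Lemma part_length_level t w x : (t < k.*2.+2)%N ->
  exists2 j, (j < k.+1)%N & length_of (part t w x) = 650 * 6 ^+ j.
Proof.
move=> tn; exists (minn t (k.*2.+1 - t)); first lia.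
exact: part_length (sign_sqr t) (scale_gt0 t).
Qed.

End Drawing.

(** * The graph of the drawing *)

Section Graph.
Variables (R : realType) (k : nat).
Local Notation plane := 'rV[R]_2.

Definition part_index := ('I_(k.*2.+2) * (bool * option bool))%type.

Definition ends_of (v : part_index) : plane * plane := part R k v.1 v.2.1 v.2.2.

Definition chain_adj (v w : part_index) : bool :=
  (v != w) && `[< meet (ends_of v) (ends_of w) >].

Lemma chain_adj_sym : symmetric chain_adj.
Proof.
move=> v w; rewrite /chain_adj eq_sym; congr andb.
by apply: asbool_equiv_eq; rewrite /meet setIC.
Qed.

Lemma chain_adj_irr : irreflexive chain_adj.
Proof. by move=> v; rewrite /chain_adj eqxx. Qed.

Definition chain_graph : sgraph := SGraph chain_adj_sym chain_adj_irr.

Lemma ends_of_inj v w : seg (ends_of v) = seg (ends_of w) -> v = w.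
Proof.
case: v w => [t [b x]] [t' [b' x']] /(part_inj (ltn_ord t) (ltn_ord t')) /= [e -> ->].
by rewrite (val_inj e).
Qed.

Lemma chain_graph_upper : length_segment_graph R k.+1 chain_graph.
Proof.
exists (range (fun v => seg (ends_of v))); split.
- by exists (seg (ends_of (ord0, (false, None)))); exists (ord0, (false, None)).
- move=> _ [v _ <-]; exists (ends_of v).1, (ends_of v).2; split=> //.
  have [j _] := part_length_level R v.2.1 v.2.2 (ltn_ord v.1).
  rewrite -/(ends_of v) /length_of edistE => l; apply/eqP => e.
  have : 0 < 650 * 6 ^+ j :> R by rewrite mulr_gt0 ?exprn_gt0.
  by rewrite -l e /dist2 !subrr expr0n addr0 sqrtr0 ltxx.
- apply: card_le_trans (card_image_le (fun j => 650 * 6 ^+ j : R) _).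
  apply: subset_card_le => l [a [b [ab [v _ e] ->]]].
  have [j jk lj] := part_length_level R v.2.1 v.2.2 (ltn_ord v.1).
  exists j => //; rewrite -lj -/(ends_of v).
  have {}e : segment (ends_of v).1 (ends_of v).2 = segment a b := e.
  apply: le_anti; apply/andP; split; apply: edist_segment.
  - by rewrite -e; exact: segment_left.
  - by rewrite -e; exact: segment_right.
  - by rewrite e; exact: segment_left.
  - by rewrite e; exact: segment_right.
- exists (fun v => seg (ends_of v)); split.
    split; first by move=> v _; exists v.
      by move=> v w _ _ /ends_of_inj.
    by move=> _ [v _ <-]; exists v.
  move=> v w; split.
    by move=> /andP[/eqP vw /asboolP m]; split=> // /ends_of_inj.
  move=> [vw m]; apply/andP; split; last exact/asboolP.
  by apply: contra_notN vw => /eqP ->.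
Qed.

(** The drawing satisfies [triangle_chain], a condition on adjacency only, and
    so does every other representation of its intersection graph. *)
Lemma chain_graph_lower : ~ length_segment_graph R k chain_graph.
Proof.
move=> [F [_ Fseg Flen [f [[fF finj _] fadj]]]].
have /choice[g gP] : forall v : chain_graph, exists e : plane * plane, e.1 != e.2 /\ f v = seg e.
  move=> v; have [a [b [ab ->]]] := Fseg _ (fF v I).
  by exists (a, b).
have ginj v w : f v = f w -> v = w by apply: finj; rewrite in_setT.
have gmeet v w : v != w -> meet (g v) (g w) <-> meet (ends_of v) (ends_of w).
  move=> vw; have := fadj v w; rewrite /int_adj (gP v).2 (gP w).2 => h.
  split=> [m|m].
    have /h /andP[_ /asboolP //] : seg (g v) <> seg (g w) /\ seg (g v) `&` seg (g w) !=set0.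
    split=> // e; move/eqP: vw; apply; apply: ginj.
    by rewrite (gP v).2 (gP w).2.
  by have /h[] : @adj chain_graph v w by apply/andP; split=> //; apply/asboolP.
pose side t x := g (inord t, (false, x)); pose spoke t x := g (inord t, (true, x)).
have pE t b x : (t < k.*2.+2)%N -> ends_of (inord t, (b, x)) = part R k t b x.
  by move=> tn; rewrite /ends_of /= inordK.
have apt v w : v != w -> apart (ends_of v) (ends_of w) -> apart (g v) (g w).
  move=> vw ap; apply/eqP/negPn/negP => /set0P m.
  have [z [z1 z2]] := (gmeet v w vw).1 m.
  exact: apart_notin ap z1 z2.
have adjv t t' b b' x x' : (t < k.*2.+2)%N -> (t' < k.*2.+2)%N ->
    (t, (b, x)) != (t', (b', x')) ->
    (inord t, (b, x)) != (inord t', (b', x')) :> part_index.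
  move=> tn t'n; apply: contra => /eqP[e -> ->].
  by rewrite -(inordK tn) -(inordK t'n) e.
have dc := drawing_chain R k.
have tc : triangle_chain k.*2.+2 side spoke.
  split.
  - move=> t x y tn; have [<-|xy] := eqVneq x y.
      by exists (side t x).1; split; exact: segment_left.
    apply/gmeet; first by rewrite !xpair_eqE (negPf xy) !andbF.
    by rewrite !pE //; exact: (corner dc).
  - move=> t x tn; apply/gmeet; first by rewrite !xpair_eqE !andbF.
    by rewrite !pE //; exact: (foot dc).
  - move=> t x tn; apply/gmeet.
      by apply: adjv => //; [lia|rewrite xpair_eqE; apply/nandP; left; lia].
    by rewrite !pE //; [exact: (joint dc)|lia].
  - move=> t t' x y tn t'n tt; apply: apt.
      by apply: adjv; rewrite // xpair_eqE (negPf tt).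
    by rewrite !pE //; exact: (side_side dc).
  - move=> t t' x y tn t'n ne; apply: apt.
      by rewrite !xpair_eqE !andbF.
    by rewrite !pE //; exact: (spoke_side dc).
  - move=> t t' x y tn t'n ne; apply: apt.
      by rewrite !xpair_eqE (negPf ne) !andbF.
    by rewrite !pE //; exact: (spoke_spoke dc).
apply: (no_few_values (M := size_of side) _ (triangle_dichotomy tc) Flen).
move=> t tn; have [x ->] := size_attained side t.
exists (side t x).1, (side t x).2; split=> //; first exact: (gP _).1.
by rewrite -/(seg (side t x)) -(gP _).2; exact: fF.
Qed.

End Graph.

Theorem theorem6 (R : realType) (k : nat) (hk : (1 <= k)%N) :
  (forall G : sgraph,
     length_segment_graph R k G -> length_segment_graph R k.+1 G) /\
  (exists G : sgraph,
     length_segment_graph R k.+1 G /\ ~ length_segment_graph R k G).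
Proof.
split.
  move=> G [F [F0 Fseg Flen FG]]; exists F; split=> //.
  by apply: card_le_trans Flen _; rewrite card_le_II.
exists (chain_graph R k).
by split; [exact: chain_graph_upper|exact: chain_graph_lower].
Qed.
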